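(* If $G$ is a torsion-free abelian group, then the group of units of the group algebra $\mathbf{F}_2[G]$ satisfies $(\mathbf{F}_2[G])^\times \cong G$. In particular, every indecomposable torsion-free abelian group is isomorphic to the unit group of a commutative ring.
   Context: $G$ is written multiplicatively. $\mathbf{F}_2$ is the field with two elements and $\mathbf{F}_2[G]$ is the group algebra of $G$ over $\mathbf{F}_2$. A group is torsion-free if its only element of finite order is the identity; it is indecomposable if it is not isomorphic to the direct product of two non-trivial groups. No finite generation or finite rank assumption is made on $G$. *)

(* Defs.v *)
(* Groups, possibly infinite, are the [groupType]s of mathcomp.boot.monoid. *)
From HB Require Import structures.
From mathcomp Require Import all_boot all_algebra finmap.
From mathcomp.multinomials Require Import monalg.

Set Implicit Arguments.
Unset Strict Implicit.
Unset Printing Implicit Defensive.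

Import GRing.Theory.

Local Open Scope ring_scope.

Section GroupNotions.
Local Open Scope group_scope.

Definition abelian_group (G : groupType) : Prop :=
  forall x y : G, commute x y.

Definition torsion_free (G : groupType) : Prop :=
  forall (x : G) (n : nat), (0 < n)%N -> x ^+ n = 1 -> x = 1.

Definition isomorphic (G H : groupType) : Prop :=
  exists f : {multiplicative G -> H}, bijective f.

Definition nontrivial (G : groupType) : Prop := exists x : G, x <> 1.

(* The trivial group counts as indecomposable. *)
Definition indecomposable (G : groupType) : Prop :=
  ~ exists H K : groupType,
      [/\ nontrivial H, nontrivial K & isomorphic G (H * K)%type].

End GroupNotions.

Section UnitGroup.
Variable R : pzRingType.

(* MathComp's [{unit R}] is restricted to finite rings, and [GRing.unit] to
   rings with a chosen inverse function. Here a unit is given together with its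
   two-sided inverse, which it determines (see [unit_valI]). *)
Record unit_group : predArgType := UnitGroup {
  unit_pair : R * R;
  _ : (unit_pair.1 * unit_pair.2 == 1) && (unit_pair.2 * unit_pair.1 == 1)
}.

HB.instance Definition _ := [isSub for unit_pair].
HB.instance Definition _ := [Choice of unit_group by <:].

Implicit Types u v : unit_group.

Definition unit_val u : R := (unit_pair u).1.
Definition unit_inv_val u : R := (unit_pair u).2.

Lemma unit_valV u : unit_val u * unit_inv_val u = 1.
Proof. by have /andP[/eqP] := valP u. Qed.

Lemma unit_Vval u : unit_inv_val u * unit_val u = 1.
Proof. by have /andP[_ /eqP] := valP u. Qed.

Lemma unit_valI : injective unit_val.
Proof.
move=> u v uv; apply: val_inj; rewrite /= [LHS]surjective_pairing.
rewrite [RHS]surjective_pairing; congr pair; first exact: uv.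
rewrite -/(unit_inv_val u) -/(unit_inv_val v).
by rewrite -[LHS]mulr1 -(unit_valV v) -uv mulrA unit_Vval mul1r.
Qed.

Lemma unit_valP (x : R) :
  (exists u, unit_val u = x) <-> (exists y, x * y = 1 /\ y * x = 1).
Proof.
split=> [[u <-]|[y [xy yx]]].
  by exists (unit_inv_val u); rewrite unit_valV unit_Vval.
have h : ((x, y).1 * (x, y).2 == 1) && ((x, y).2 * (x, y).1 == 1).
  by rewrite /= xy yx eqxx.
by exists (UnitGroup h).
Qed.

Fact unit_one_subproof :
  ((1 : R, 1 : R).1 * (1 : R, 1 : R).2 == 1)
    && ((1 : R, 1 : R).2 * (1 : R, 1 : R).1 == 1).
Proof. by rewrite /= mulr1 eqxx. Qed.

Definition unit_one := UnitGroup unit_one_subproof.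

Fact unit_inv_subproof u (p := (unit_inv_val u, unit_val u)) :
  (p.1 * p.2 == 1) && (p.2 * p.1 == 1).
Proof. by rewrite /= unit_valV unit_Vval eqxx. Qed.

Definition unit_inv u := UnitGroup (unit_inv_subproof u).

Fact unit_mul_subproof u v
    (p := (unit_val u * unit_val v, unit_inv_val v * unit_inv_val u)) :
  (p.1 * p.2 == 1) && (p.2 * p.1 == 1).
Proof.
rewrite /= mulrA -(mulrA (unit_val u)) unit_valV mulr1 unit_valV eqxx /=.
by rewrite mulrA -(mulrA (unit_inv_val v)) unit_Vval mulr1 unit_Vval.
Qed.

Definition unit_mul u v := UnitGroup (unit_mul_subproof u v).

Fact unit_mulA : associative unit_mul.
Proof. by move=> u v w; apply: unit_valI; rewrite /unit_val /= mulrA. Qed.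

Fact unit_mul1u : left_id unit_one unit_mul.
Proof. by move=> u; apply: unit_valI; rewrite /unit_val /= mul1r. Qed.

Fact unit_mulu1 : right_id unit_one unit_mul.
Proof. by move=> u; apply: unit_valI; rewrite /unit_val /= mulr1. Qed.

Fact unit_mulVu : left_inverse unit_one unit_inv unit_mul.
Proof. by move=> u; apply: unit_valI; exact: unit_Vval. Qed.

Fact unit_muluV : right_inverse unit_one unit_inv unit_mul.
Proof. by move=> u; apply: unit_valI; exact: unit_valV. Qed.

HB.instance Definition _ := isGroup.Build unit_group
  unit_mulA unit_mul1u unit_mulu1 unit_mulVu unit_muluV.

Lemma unit_val1 : unit_val 1%g = 1. Proof. by []. Qed.

Lemma unit_valM u v : unit_val (u * v)%g = unit_val u * unit_val v.
Proof. by []. Qed.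

End UnitGroup.

(* Finitely supported functions G -> R. The ring structure that [monalg] puts on
   [{malg R[K]}] is not available here: it requires a monoid K in which 1 is the
   only invertible element. *)
Definition group_algebra (R : nzRingType) (G : groupType) : Type :=
  {malg R[G]}.

Section GroupAlgebra.
Variables (R : nzRingType) (G : groupType).

Local Open Scope fset_scope.

HB.instance Definition _ := GRing.Lmodule.on (group_algebra R G).

Implicit Types a b c : {malg R[G]}.

Definition gaone : {malg R[G]} := << (1 : R) *g (1%g : G) >>.

Definition gamul a b : {malg R[G]} :=
  \sum_(x <- msupp a) \sum_(y <- msupp b) << a@_x * b@_y *g (x * y)%g >>.

Lemma gamulw (d1 d2 : {fset G}) a b :
  msupp a `<=` d1 -> msupp b `<=` d2 ->
  gamul a b =
    \sum_(x <- d1) \sum_(y <- d2) << a@_x * b@_y *g (x * y)%g >>.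
Proof.
move=> le_d1 le_d2; rewrite /gamul (big_fset_incl _ le_d1) /=.
  apply/eq_bigr=> x _; apply/big_fset_incl => // y _ /mcoeff_outdom ->.
  by rewrite mulr0 monalgU0.
move=> x _ /mcoeff_outdom ax.
by rewrite big1 // => y _; rewrite ax mul0r monalgU0.
Qed.

Fact gamulDl : left_distributive gamul +%R.
Proof.
move=> a b c.
rewrite (gamulw (msuppD_le a b) (fsubset_refl (msupp c))).
rewrite (gamulw (fsubsetUl (msupp a) (msupp b)) (fsubset_refl (msupp c))).
rewrite (gamulw (fsubsetUr (msupp a) (msupp b)) (fsubset_refl (msupp c))).
rewrite -big_split /=; apply/eq_bigr=> x _.
rewrite -big_split /=; apply/eq_bigr=> y _.
by rewrite mcoeffD mulrDl monalgUD.
Qed.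

Fact gamulDr : right_distributive gamul +%R.
Proof.
move=> c a b.
rewrite (gamulw (fsubset_refl (msupp c)) (msuppD_le a b)).
rewrite (gamulw (fsubset_refl (msupp c)) (fsubsetUl (msupp a) (msupp b))).
rewrite (gamulw (fsubset_refl (msupp c)) (fsubsetUr (msupp a) (msupp b))).
rewrite -big_split /=; apply/eq_bigr=> x _.
rewrite -big_split /=; apply/eq_bigr=> y _.
by rewrite mcoeffD mulrDr monalgUD.
Qed.

Fact gamul0a : left_zero 0 gamul.
Proof. by move=> a; rewrite /gamul msupp0 big_seq_fset0. Qed.

Fact gamula0 : right_zero 0 gamul.
Proof.
by move=> a; rewrite /gamul big1 // => x _; rewrite msupp0 big_seq_fset0.
Qed.

Lemma gamulUU (r s : R) (x y : G) :
  gamul << r *g x >> << s *g y >> = << r * s *g (x * y)%g >>.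
Proof. by rewrite (gamulw msuppU_le msuppU_le) !big_seq_fset1 !mcoeffUU. Qed.

Lemma gamul_suml I (s : seq I) (F : I -> {malg R[G]}) a :
  gamul (\sum_(i <- s) F i) a = \sum_(i <- s) gamul (F i) a.
Proof. exact: (big_morph (gamul^~ a) (fun _ _ => gamulDl _ _ _) (gamul0a _)). Qed.

Lemma gamul_sumr I (s : seq I) (F : I -> {malg R[G]}) a :
  gamul a (\sum_(i <- s) F i) = \sum_(i <- s) gamul a (F i).
Proof. exact: (big_morph (gamul a) (fun _ _ => gamulDr _ _ _) (gamula0 _)). Qed.

Fact gamul1a : left_id gaone gamul.
Proof.
move=> a; rewrite [in LHS](monalgE a) [RHS]monalgE gamul_sumr.
by apply/eq_bigr=> x _; rewrite gamulUU mul1r mul1g.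
Qed.

Fact gamula1 : right_id gaone gamul.
Proof.
move=> a; rewrite [in LHS](monalgE a) [RHS]monalgE gamul_suml.
by apply/eq_bigr=> x _; rewrite gamulUU mulr1 mulg1.
Qed.

Fact gamulA : associative gamul.
Proof.
move=> a b c; rewrite (monalgE a) !gamul_suml; apply/eq_bigr=> x _.
rewrite (monalgE b) !(gamul_suml, gamul_sumr); apply/eq_bigr=> y _.
rewrite (monalgE c) !gamul_sumr; apply/eq_bigr=> z _.
by rewrite !gamulUU mulrA mulgA.
Qed.

Fact gaone_neq0 : gaone != 0.
Proof. by rewrite monalgU_eq0 oner_eq0. Qed.

HB.instance Definition _ := GRing.Zmodule_isNzRing.Build (group_algebra R G)
  gamulA gamul1a gamula1 gamulDl gamulDr gaone_neq0.

End GroupAlgebra.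

(* Main.v *)
(* A torsion-free abelian group G can be totally ordered, so in an equation
   a * b = 1 of R[G], R a domain, the product of the largest elements of the two
   supports and the product of the smallest ones each arise in only one way,
   hence lie in the support of 1. Both products are thus 1, which forces a and b
   to be monomials; over F_2 the coefficient is 1 and the units are the elements
   of G. Only finitely many elements need to be compared, and a pointed submonoid
   of G deciding them is built one element at a time: if neither x nor x^-1 can
   be added to P then P contains x^-k and x^l with k, l > 0, hence x^(kl) and its
   inverse, so that x = 1. *)
From Stdlib Require Import Classical.
Require Import Defs.
From HB Require Import structures.
From mathcomp Require Import all_boot all_algebra finmap.
From mathcomp.multinomials Require Import monalg.

Set Implicit Arguments.
Unset Strict Implicit.
Unset Printing Implicit Defensive.

Import GRing.Theory.

Section PositiveCones.
Variable G : groupType.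
Hypothesis abelG : abelian_group G.
Local Open Scope group_scope.

Implicit Types (P : G -> Prop) (x y z t : G).

Lemma abelian_mulgACA x y z t : (x * y) * (z * t) = (x * z) * (y * t).
Proof.
by rewrite -!mulgA; congr (_ * _); rewrite !mulgA (abelG y).
Qed.

(* The nonnegative elements of the translation-invariant partial order in which
   x <= y means P (x^-1 * y). *)
Definition positive_cone P : Prop :=
  [/\ P 1, forall x y, P x -> P y -> P (x * y)
    & forall x, P x -> P x^-1 -> x = 1].

Definition adjoin P x : G -> Prop :=
  fun z => exists p n, P p /\ z = p * x ^+ n.

Lemma positive_coneX P x n : positive_cone P -> P x -> P (x ^+ n).
Proof.
case=> P1 PM _ Px; elim: n => [|n IHn]; first by rewrite expg0.
by rewrite expgS; apply: PM.
Qed.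

Lemma positive_coneV P :
  positive_cone P -> positive_cone (fun x => P x^-1).
Proof.
case=> P1 PM PV; split=> [|x y Px Py|x Px]; first by rewrite invg1.
  by rewrite abelG invgM; apply: PM.
by rewrite invgK => /PV; apply.
Qed.

Lemma positive_cone_adjoin P x : positive_cone P ->
  positive_cone (adjoin P x) \/ exists2 k, (0 < k)%N & P (x ^+ k)^-1.
Proof.
move=> [P1 PM PV].
have [noinv|] := classic (forall k, P (x ^+ k)^-1 -> k = 0%N); last first.
  move=> /not_all_ex_not[k Pk]; right; exists k; last first.
    by apply: NNPP => nPk; apply: Pk.
  by rewrite lt0n; apply/eqP => k0; apply: Pk.
left; split=> [|_ _ [p [n [Pp ->]]] [q [m [Pq ->]]]|_ [p [n [Pp ->]]]].
- by exists 1, 0%N; rewrite expg0 mulg1.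
- exists (p * q), (n + m)%N; rewrite abelian_mulgACA -expgnDr.
  by split; first exact: PM.
- move=> [q [m [Pq /(congr1 (fun z => p * x ^+ n * z))]]].
  rewrite mulgV abelian_mulgACA -expgnDr => /esym pqE.
  have /noinv/eqP : P (x ^+ (n + m))^-1.
    by rewrite -(mulg1_eq pqE) invgK; apply: PM.
  rewrite addn_eq0 => /andP[/eqP n0 /eqP m0]; move: pqE.
  by rewrite n0 m0 expg0 !mulg1 => /mulg1_eq pVE; apply: PV; rewrite ?pVE.
Qed.

Lemma adjoin_sub P x : forall z, P z -> adjoin P x z.
Proof. by move=> z Pz; exists z, 0%N; rewrite expg0 mulg1. Qed.

Lemma adjoin_gen P x : positive_cone P -> adjoin P x x.
Proof. by case=> P1 _ _; exists 1, 1%N; rewrite mul1g expg1. Qed.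

Hypothesis tfG : torsion_free G.

Lemma positive_cone_extend P x : positive_cone P ->
  exists Q, [/\ positive_cone Q, forall z, P z -> Q z & Q x \/ Q x^-1].
Proof.
move=> coneP.
have [coneQ|[k k_gt0 Pk]] := positive_cone_adjoin x coneP.
  exists (adjoin P x); split=> //; first exact: adjoin_sub.
  by left; apply: adjoin_gen.
have [coneQ|[l l_gt0 Pl]] := positive_cone_adjoin x^-1 coneP.
  exists (adjoin P x^-1); split=> //; first exact: adjoin_sub.
  by right; apply: adjoin_gen.
have [P1 _ PV] := coneP.
exists P; split=> //; left; suff -> : x = 1 by [].
apply: (tfG (n := (k * l)%N)); first by rewrite muln_gt0 k_gt0.
apply: PV; last by rewrite expgnA -expVgn; apply: positive_coneX.
rewrite mulnC expgnA; apply: positive_coneX => //.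
by move: Pl; rewrite expVgn invgK.
Qed.

Lemma positive_cone_total_on (s : seq G) :
  exists2 P, positive_cone P & forall x, x \in s -> P x \/ P x^-1.
Proof.
elim: s => [|x s [P coneP totP]].
  by exists (fun x => x = 1) => //; split=> // x y -> ->; rewrite mulg1.
have [Q [coneQ subPQ Qx]] := positive_cone_extend x coneP.
exists Q => // y; rewrite inE => /predU1P[->//|/totP[]/subPQ].
  by left.
by right.
Qed.

Lemma positive_cone_max P (A : seq G) : positive_cone P ->
    {in A &, forall x y, P (x^-1 * y) \/ P (x^-1 * y)^-1} -> A != [::] ->
  exists2 m, m \in A & forall x, x \in A -> P (x^-1 * m).
Proof.
move=> [P1 PM _]; elim: A => // a A IHA totA _.
have [->|A_neq0] := eqVneq A [::].
  by exists a => [|x]; rewrite inE // => /eqP->; rewrite mulVg.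
have [x y Ax Ay|//|m Am maxm] := IHA.
  by apply: totA; rewrite inE (Ax, Ay) orbT.
have : P (a^-1 * m) \/ P (a^-1 * m)^-1.
  by apply: totA; rewrite inE ?eqxx ?Am ?orbT.
rewrite invgM invgK => -[Pam|Pma].
  exists m => [|x]; first by rewrite inE Am orbT.
  by rewrite inE => /predU1P[->//|/maxm].
exists a => [|x]; first exact: mem_head.
rewrite inE => /predU1P[->|/maxm Pxm]; first by rewrite mulVg.
by have := PM _ _ Pxm Pma; rewrite -mulgA mulVKg.
Qed.

Lemma positive_cone_mul_inj P x y x' y' : positive_cone P ->
  P (x^-1 * x') -> P (y^-1 * y') -> x * y = x' * y' -> x = x' /\ y = y'.
Proof.
move=> [_ _ PV] Px Py xyE.
have xy1 : x^-1 * x' * (y^-1 * y') = 1.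
  by rewrite abelian_mulgACA -xyE -invgM (abelG y) mulVg.
have /mulg1_eq : y^-1 * y' = 1 by apply: PV; rewrite // -(mulg1_eq xy1) invgK.
rewrite invgK => yy'; move: xyE xy1; rewrite yy' => /mulIg-> //.
Qed.

End PositiveCones.

Section GroupAlgebraUnits.
Local Open Scope ring_scope.
Variables (R : idomainType) (G : groupType).
Implicit Types a b : {malg R[G]}.

Lemma gamulC : abelian_group G -> commutative (@gamul R G).
Proof.
move=> abelG a b; rewrite /gamul exchange_big; apply: eq_bigr => x _.
by apply: eq_bigr => y _; rewrite mulrC abelG.
Qed.

Lemma mcoeff_gamul_unique a b x0 y0 :
    x0 \in msupp a -> y0 \in msupp b ->
    (forall x y, x \in msupp a -> y \in msupp b -> (x * y = x0 * y0)%g ->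
      x = x0 /\ y = y0) ->
  (gamul a b)@_(x0 * y0)%g = a@_x0 * b@_y0.
Proof.
move=> ax0 by0 uniq0; rewrite /gamul raddf_sum /= (big_fsetD1 x0) //=.
rewrite raddf_sum (big_fsetD1 y0) //= mcoeffUU big_seq big1 => [|y].
  rewrite addr0 big_seq big1 ?addr0 // => x; rewrite !inE => /andP[xx0 ax].
  rewrite raddf_sum big_seq big1 //= => y yb; rewrite mcoeffU.
  by case: eqP => // /uniq0[] // /eqP; rewrite (negPf xx0).
rewrite !inE => /andP[yy0 yb]; rewrite mcoeffU.
by case: eqP => // /uniq0[] // _ /eqP; rewrite (negPf yy0).
Qed.

Hypotheses (abelG : abelian_group G) (tfG : torsion_free G).

Lemma gamul_extremal a b (P : G -> Prop) x0 y0 :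
    positive_cone P -> gamul a b = gaone R G ->
    x0 \in msupp a -> y0 \in msupp b ->
    (forall x, x \in msupp a -> P (x^-1 * x0)%g) ->
    (forall y, y \in msupp b -> P (y^-1 * y0)%g) ->
  (x0 * y0 = 1)%g.
Proof.
move=> coneP ab1 ax0 by0 maxx maxy.
have := mcoeff_gamul_unique ax0 by0 (fun x y ax yb =>
  positive_cone_mul_inj abelG coneP (maxx x ax) (maxy y yb)).
rewrite ab1 mcoeffU; case: eqP => // _ /esym/eqP.
by rewrite mulf_eq0 !mcoeff_eq0 ax0 by0.
Qed.

Lemma gamul_eq1_monomial a b : gamul a b = gaone R G ->
  exists x, a = << a@_x *g x >>.
Proof.
move=> ab1.
have [P coneP totP] := positive_cone_total_on abelG tfG
  ([seq x^-1 * y | x <- msupp a, y <- msupp a]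
    ++ [seq x^-1 * y | x <- msupp b, y <- msupp b])%g.
have tota : {in msupp a &, forall x y, P (x^-1 * y)%g \/ P (x^-1 * y)^-1%g}.
  by move=> x y ax ay; apply: totP; rewrite mem_cat; apply/orP; left;
    apply/allpairsP; exists (x, y).
have totb : {in msupp b &, forall x y, P (x^-1 * y)%g \/ P (x^-1 * y)^-1%g}.
  by move=> x y bx yb; apply: totP; rewrite mem_cat; apply/orP; right;
    apply/allpairsP; exists (x, y).
have nz (c : {malg R[G]}) : c <> 0 -> (msupp c : seq G) != [::].
  move=> c0; apply/eqP => s0; apply/c0/malgP => x.
  by rewrite mcoeff0 mcoeff_outdom // -[x \in _]/(x \in (msupp c : seq G)) s0.
have a0 : a <> 0.
  by move=> a0; move: ab1 (gaone_neq0 R G) => <-; rewrite a0 gamul0a eqxx.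
have b0 : b <> 0.
  by move=> b0; move: ab1 (gaone_neq0 R G) => <-; rewrite b0 gamula0 eqxx.
have conePV := positive_coneV abelG coneP.
have [x0 ax0 maxx] := positive_cone_max coneP tota (nz _ a0).
have [y0 by0 maxy] := positive_cone_max coneP totb (nz _ b0).
have swap (c : {malg R[G]}) :
    {in msupp c &, forall x y, P (x^-1 * y)%g \/ P (x^-1 * y)^-1%g} ->
  {in msupp c &, forall x y, P (x^-1 * y)^-1%g \/ P ((x^-1 * y)^-1)^-1%g}.
  by move=> tot x y cx cy; rewrite invgK; apply/or_comm/tot.
have [x1 ax1 minx] := positive_cone_max conePV (swap _ tota) (nz _ a0).
have [y1 by1 miny] := positive_cone_max conePV (swap _ totb) (nz _ b0).
have xy0 := gamul_extremal coneP ab1 ax0 by0 maxx maxy.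
have xy1 := gamul_extremal conePV ab1 ax1 by1 minx miny.
have [x10 _] := positive_cone_mul_inj abelG coneP (maxx _ ax1) (maxy _ by1)
  (etrans xy1 (esym xy0)).
exists x0; apply/malgP => z; rewrite mcoeffU; case: eqP => [->//|xz].
apply: mcoeff_outdom; apply/negP => az; apply: xz; apply/esym.
have [_ _ PV] := coneP.
have zx0 : (z^-1 * x0 = 1)%g.
  by apply: PV; [exact: maxx | rewrite -x10; exact: minx].
by move: zx0 => /mulg1_eq; rewrite invgK.
Qed.

End GroupAlgebraUnits.

Lemma isomorphic_sym (G H : groupType) : isomorphic G H -> isomorphic H G.
Proof.
move=> [f [g fK gK]].
have gM : {morph g : x y / (x * y)%g}.
  by move=> x y; apply: (can_inj fK); rewrite gK gmulfM !gK.
pose g' := HB.pack_for {multiplicative H -> G} g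
  (monoid.isMultiplicative.Build H G g gM).
by exists g'; exists f.
Qed.

Section Monomials.
Local Open Scope ring_scope.
Variable G : groupType.

Fact monomial_unit_subproof (x : G)
    (p := (<< 1 *g x >> : group_algebra 'F_2 G,
           << 1 *g x^-1%g >> : group_algebra 'F_2 G)) :
  (p.1 * p.2 == 1) && (p.2 * p.1 == 1).
Proof. by rewrite /p /= /GRing.mul /= !gamulUU mulr1 mulgV mulVg !eqxx. Qed.

Definition monomial_unit (x : G) : unit_group (group_algebra 'F_2 G) :=
  UnitGroup (monomial_unit_subproof x).

Fact monomial_unitM : {morph monomial_unit : x y / (x * y)%g}.
Proof.
by move=> x y; apply: unit_valI; rewrite unit_valM [RHS]gamulUU mulr1.
Qed.

HB.instance Definition _ := monoid.isMultiplicative.Build _ _ _ monomial_unitM.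

Lemma unit_group_algebra_F2 : abelian_group G -> torsion_free G ->
  isomorphic G (unit_group (group_algebra 'F_2 G)).
Proof.
move=> abelG tfG.
exists monomial_unit; pose f (u : unit_group (group_algebra 'F_2 G)) :=
  head 1%g (msupp (unit_val u : {malg 'F_2[G]})).
have fK : cancel monomial_unit f.
  move=> x; rewrite /f /= msuppU oner_eq0.
  have /perm_small_eq -> // : perm_eq [fset x]%fset [:: x].
  by apply: uniq_perm => // y; rewrite !inE.
exists f => // u.
have [x uE] := gamul_eq1_monomial abelG tfG (unit_valV u).
suff -> : u = monomial_unit x by rewrite fK.
apply: unit_valI; rewrite [LHS]uE; congr << _ *g x >>.
have : (unit_val u : {malg 'F_2[G]})@_x != 0.
  apply/eqP => ux0; have := unit_valV u; rewrite uE ux0 monalgU0.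
  by rewrite [LHS]gamul0a => /esym/eqP; rewrite (negPf (gaone_neq0 _ _)).
by case: (_ @_x) => -[|[|//]] i // _; apply: val_inj.
Qed.

End Monomials.

Theorem theorem3p3 :
  (forall G : groupType, abelian_group G -> torsion_free G ->
     isomorphic (unit_group (group_algebra 'F_2 G)) G) /\
  (forall G : groupType, abelian_group G -> torsion_free G ->
     indecomposable G ->
     exists R : comPzRingType, isomorphic G (unit_group R)).
Proof.
split=> G abelG tfG => [|_]; first exact/isomorphic_sym/unit_group_algebra_F2.
pose R := HB.pack_for comPzRingType (group_algebra 'F_2 G)
  (GRing.PzRing_hasCommutativeMul.Build (group_algebra 'F_2 G) (gamulC abelG)).
by exists R; exact: unit_group_algebra_F2.
Qed.
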